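(* Let $k\geq 4$ be even, let $n\geq 1$, and let $\mathsf{A}\in\mathbb{R}^{n\times n\times\cdots\times n\times n}$ be a $k$th order supersymmetric tensor that is orthogonally decomposable. Let $\mathbf{x}_0\in\mathbb{R}^n$ be an initial condition, and let $\mu$ be the spectral radius of the unfolded matrix $\psi(\mathsf{A})$. For the multilinear dynamical system $\mathbf{x}_{t+1}=\mathsf{A}\mathbf{x}_t^{k-1}$ started at $\mathbf{x}_0$, the equilibrium point $\mathbf{x}=\mathbf{0}$ is asymptotically stable if $\mu^{\frac{1}{k-2}}\|\mathbf{x}_0\|<1$.
   Context: A $k$th order tensor $\mathsf{A}\in\mathbb{R}^{n\times\cdots\times n}$ ($k$ modes, each of size $n$) is supersymmetric if its entries are invariant under any permutation of the indices. It is orthogonally decomposable (odeco) if it can be written as $\mathsf{A}=\sum_{r=1}^n\lambda_r\,\mathbf{v}_r\circ\cdots\circ\mathbf{v}_r$ ($k$ factors) with $\lambda_r\in\mathbb{R}$ and $\mathbf{v}_1,\dots,\mathbf{v}_n\in\mathbb{R}^n$ orthonormal, where $\circ$ is the vector outer product. The vector $\mathsf{A}\mathbf{x}^{k-1}\in\mathbb{R}^n$ is given by $(\mathsf{A}\mathbf{x}^{k-1})_{j}=\sum_{j_1,\dots,j_{k-1}=1}^n\mathsf{A}_{j_1\dots j_{k-1}j}\,\mathbf{x}_{j_1}\cdots\mathbf{x}_{j_{k-1}}$. Time $t=0,1,2,\dots$ is discrete. For an even order $k=2m$, the unfolded matrix $\psi(\mathsf{A})\in\mathbb{R}^{n^m\times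 n^m}$ has entries $\psi(\mathsf{A})_{ji}=\mathsf{A}_{j_1i_1j_2i_2\dots j_mi_m}$, where $j=j_1+\sum_{p=2}^m(j_p-1)n^{p-1}$ and $i=i_1+\sum_{p=2}^m(i_p-1)n^{p-1}$ with all $j_p,i_p\in\{1,\dots,n\}$. The spectral radius of a square matrix is the maximum of the absolute values of its eigenvalues. The equilibrium $\mathbf{x}=\mathbf{0}$ is asymptotically stable (for the given initial condition $\mathbf{x}_0$) if the trajectory starting at $\mathbf{x}_0$ satisfies $\mathbf{x}_t\to\mathbf{0}$ as $t\to\infty$. Here $\|\cdot\|$ is the Euclidean norm. *)

(* Defs.v *)
From mathcomp Require Export all_boot all_order all_algebra all_fingroup.
From mathcomp Require Export all_classical all_reals all_analysis.
From mathcomp.real_closed Require Export complex.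

Set Implicit Arguments.
Unset Strict Implicit.
Unset Printing Implicit Defensive.

Import Order.TTheory GRing.Theory Num.Theory.
Import numFieldNormedType.Exports.

Local Open Scope classical_set_scope.
Local Open Scope ring_scope.

(* All indices are 0-based: a mode ranges over 'I_n and modes are numbered by
   'I_k, so the p-th index (p >= 1) of a 1-based convention is [J (p - 1)]. *)
Definition multi_index (n k : nat) := {ffun 'I_k -> 'I_n}.

Definition tensor (R : Type) (n k : nat) := multi_index n k -> R.

Definition supersymmetric (R : Type) n k (A : tensor R n k) : Prop :=
  forall (s : 'S_k) (J : multi_index n k), A [ffun p => J (s p)] = A J.

Definition outer (R : realType) n k (v : 'I_k -> 'cV[R]_n) : tensor R n k :=
  fun J => \prod_(p < k) v p (J p) 0.

Definition dot (R : realType) n (x y : 'cV[R]_n) : R := \sum_i x i 0 * y i 0.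

Definition euclid_norm (R : realType) n (x : 'cV[R]_n) : R :=
  Num.sqrt (dot x x).

Definition orthonormal (R : realType) n (v : 'I_n -> 'cV[R]_n) : Prop :=
  forall r s, dot (v r) (v s) = (r == s)%:R.

Definition odeco (R : realType) n k (A : tensor R n k) : Prop :=
  exists (lambda : 'I_n -> R) (v : 'I_n -> 'cV[R]_n),
    orthonormal v /\
    forall J, A J = \sum_r lambda r * outer (fun _ : 'I_k => v r) J.

(* The multi-index (j_1, ..., j_{k-1}, j): [insub] succeeds on every mode but
   the last one. *)
Definition snoc_index n k (J : multi_index n k.-1) (j : 'I_n) :
    multi_index n k :=
  [ffun q : 'I_k => if insub (val q) is Some p then J p else j].

(* The vector A x^(k-1). *)
Definition contract (R : realType) n k (A : tensor R n k) (x : 'cV[R]_n) :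
    'cV[R]_n :=
  \col_j \sum_(J : multi_index n k.-1)
            A (snoc_index J j) * \prod_(p < k.-1) x (J p) 0.

Definition trajectory (R : realType) n k (A : tensor R n k) (x0 : 'cV[R]_n) :
    nat -> 'cV[R]_n :=
  fun t => iter t (contract A) x0.

(* Stability is relative to the given initial condition. The topology on
   'cV[R]_n is the canonical (entrywise) one, which is the Euclidean one. *)
Definition asymptotically_stable (R : realType) n k (A : tensor R n k)
    (x0 : 'cV[R]_n) : Prop :=
  trajectory A x0 @ \oo --> (0 : 'cV[R]_n).

Lemma digit_subproof n m (j : 'I_(n ^ m)) (p : 'I_m) : (j %/ n ^ p %% n < n)%N.
Proof.
rewrite ltn_mod; case: n j => // j.
by case: m p j => [[]//|m] p [j]; rewrite exp0n.
Qed.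

(* The p-th base-n digit of j, least significant first: the inverse of the
   index map j = \sum_p j_p n^p, see [digitE]. *)
Definition digit n m (j : 'I_(n ^ m)) (p : 'I_m) : 'I_n :=
  Ordinal (digit_subproof j p).

Lemma digitE n m (j : 'I_(n ^ m)) : (j : nat) = (\sum_(p < m) digit j p * n ^ p)%N.
Proof.
have aux (a : nat) :
    (a %% n ^ m = \sum_(p < m) (a %/ n ^ p %% n) * n ^ p)%N.
  elim: m {j} => [|m IH]; first by rewrite big_ord0 expn0 modn1.
  rewrite big_ord_recr /= -IH expnSr.
  have [->|n0] := posnP n.
    by case: m {IH} => [|m]; rewrite ?expn0 ?mul1n ?modn0 ?modn1 ?divn1 ?muln1
       ?exp0n // ?muln0 ?modn0 ?addn0.
  have nm0 : (0 < n ^ m)%N by rewrite expn_gt0 n0.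
  rewrite {1}(divn_eq a (n ^ m)) {1}(divn_eq (a %/ n ^ m) n).
  rewrite mulnDl -mulnA -addnA [(n * n ^ m)%N]mulnC modnMDl modn_small 1?addnC //.
  rewrite -[X in (_ < X)%N]mulnC.
  have lt1 := ltn_pmod (a %/ n ^ m) n0.
  apply: (@leq_trans ((a %/ n ^ m %% n).+1 * n ^ m)); last by rewrite leq_mul2r lt1 orbT.
  by rewrite mulSn ltn_add2r ltn_pmod.
by rewrite -{1}(modn_small (ltn_ord j)) aux.
Qed.

Lemma half_ord_subproof k (k_even : ~~ odd k) (q : 'I_k) : (q./2 < k./2)%N.
Proof.
by rewrite -ltn_double (even_halfK k_even) (leq_ltn_trans _ (ltn_ord q)) //
  -[leqRHS]odd_double_half leq_addl.
Qed.

Definition half_ord k (k_even : ~~ odd k) (q : 'I_k) : 'I_(k./2) :=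
  Ordinal (half_ord_subproof k_even q).

(* psi(A)_{ji} = A_{j_1 i_1 j_2 i_2 ... j_m i_m} with m = k/2; with modes
   numbered from 0, even modes carry digits of the row index j and odd modes
   digits of the column index i. *)
Definition unfold_mx (R : realType) n k (k_even : ~~ odd k) (A : tensor R n k) :
    'M[R]_(n ^ k./2) :=
  \matrix_(j, i)
    A [ffun q : 'I_k => digit (if odd q then i else j) (half_ord k_even q)].

(* Eigenvalues of a real matrix are taken in the complex field R[i]. *)
Definition eigenvalue_moduli (R : realType) N (M : 'M[R]_N) : set R :=
  [set ComplexField.Normc.normc z |
     z in [set z : R[i] | eigenvalue (map_mx (real_complex R) M) z]].

(* The supremum is a maximum when N > 0, see [spectral_radius_max]. *)
Definition spectral_radius (R : realType) N (M : 'M[R]_N) : R :=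
  sup (eigenvalue_moduli M).

Lemma spectral_radius_max (R : realType) N (M : 'M[R]_N) : (0 < N)%N ->
  eigenvalue_moduli M (spectral_radius M) /\
  forall a, eigenvalue_moduli M a -> a <= spectral_radius M.
Proof.
move=> N0; set S := eigenvalue_moduli M.
suff [a [Sa Sle]] : exists a, S a /\ forall b, S b -> b <= a.
  have -> : spectral_radius M = a; last by split.
  apply/le_anti/andP; split; first by apply: ge_sup => //; exists a.
  by apply: ub_le_sup => //; exists a.
set p := char_poly (map_mx (real_complex R) M).
have [rs prs] := closed_field_poly_normal p.
have SE b : S b <-> b \in [seq ComplexField.Normc.normc z | z <- rs].
  have rootE z : root p z = (z \in rs).
    by rewrite prs rootZ ?root_prod_XsubC // lead_coef_eq0 monic_neq0 ?char_poly_monic.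
  split=> [[z /=]|/mapP [z]].
    by rewrite eigenvalue_root_char rootE => zrs <-; exact: map_f.
  by rewrite -rootE -eigenvalue_root_char => ez ->; exists z.
have szrs : size rs = N.
  have := size_char_poly (map_mx (real_complex R) M); rewrite -/p prs.
  rewrite size_scale ?lead_coef_eq0 ?monic_neq0 ?char_poly_monic //.
  by rewrite size_prod_XsubC => -[].
case: rs szrs SE {prs} => [|z0 rs] /= sz SE; first by rewrite -sz in N0.
set l := ComplexField.Normc.normc z0 :: _ in SE.
have [i il] : exists2 b, b \in l & forall c, c \in l -> c <= b.
  rewrite /l; elim: [seq _ | _ <- _] (ComplexField.Normc.normc z0) => [|y s IH] x.
    by exists x; rewrite ?mem_head // => c; rewrite inE => /eqP ->.
  have [b bs bmax] := IH y.
  case: (leP x b) => xb.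
    exists b; first by rewrite inE bs orbT.
    by move=> c; rewrite inE => /orP [/eqP -> //|/bmax].
  exists x; first by rewrite mem_head.
  by move=> c; rewrite inE => /orP [/eqP -> //|/bmax /le_trans -> //]; exact: ltW.
by move=> Hmax; exists i; split; [exact/SE | move=> b /SE /Hmax].
Qed.

(* Main.v *)
(* The vectors v_r (x) ... (x) v_r, with k/2 factors, are orthonormal eigenvectors
   of psi(A) for the eigenvalues lambda_r, so |lambda_r| <= mu.  In the
   coordinates c_r = <v_r, x> the system decouples into
   c_r(t+1) = lambda_r c_r(t)^(k-1), and with q = mu |x_0|^(k-2) < 1 induction
   gives |c_r(t)| <= q^t |x_0|. *)
Require Import Defs.
From mathcomp Require Import ring.
Import Order.TTheory GRing.Theory Num.Theory.
Import numFieldNormedType.Exports.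
Local Open Scope classical_set_scope.
Local Open Scope ring_scope.

(** Positions 2p and 2p+1 are grouped into one pair, matching the alternation of row and column
    digits in the unfolding. *)
Lemma prod_half_odd (R : comPzSemiRingType) (m : nat) (F : bool -> nat -> R) :
  \prod_(q < m.*2) F (odd q) q./2 = \prod_(p < m) (F false p * F true p).
Proof.
elim: m => [|m IH]; first by rewrite !big_ord0.
rewrite doubleS !big_ord_recr /= IH /= odd_double doubleK uphalf_double.
by rewrite mulrA.
Qed.

Lemma prod_half_ord (R : comPzSemiRingType) (k : nat) (k_even : ~~ odd k)
    (F : bool -> 'I_k./2 -> R) :
  \prod_(q < k) F (odd q) (half_ord k_even q) =
  \prod_p (F false p * F true p).
Proof.
(* [G] extends [F] to all natural numbers so that the version indexed by [nat] applies; the default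
   1 is never reached. *)
pose G b j := if insub j is Some p then F b p else 1.
have GE b (p : 'I_k./2) : G b p = F b p by rewrite /G valK.
under [RHS]eq_bigr => p _ do rewrite -!GE.
have := prod_half_odd _ k./2 G; rewrite even_halfK // => <-.
by apply: eq_bigr => q _; rewrite /= -GE.
Qed.

(** Base-n digits determine the number by [digitE], and both sides have n^m elements. *)
Lemma digits_bij (n m : nat) :
  bijective (fun j : 'I_(n ^ m) => [ffun p => digit j p] : {ffun 'I_m -> 'I_n}).
Proof.
apply: inj_card_bij; last by rewrite card_ffun !card_ord.
move=> i j /ffunP ij; apply/val_inj => /=.
rewrite (digitE i) (digitE j); apply: eq_bigr => p _.
by have := ij p; rewrite !ffunE => ->.
Qed.

Lemma sum_prod_digit (R : comPzSemiRingType) (n m : nat) (f : 'I_n -> R) :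
  \sum_(j < n ^ m) \prod_(p < m) f (digit j p) = (\sum_i f i) ^+ m.
Proof.
rewrite -[in RHS](card_ord m) -prodr_const bigA_distr_bigA /=.
rewrite [RHS](reindex _ (onW_bij _ (digits_bij n m))) /=.
by apply: eq_bigr => j _; apply: eq_bigr => p _; rewrite ffunE.
Qed.

Lemma normc_real (R : rcfType) (a : R) :
  ComplexField.Normc.normc (real_complex R a) = `|a|.
Proof. by rewrite /= expr0n addr0 sqrtr_sqr. Qed.

Lemma prod_snoc_index (R : comPzSemiRingType) (n k : nat) (F : 'I_n -> R)
    (J : multi_index n k.-1) (j : 'I_n) : (0 < k)%N ->
  \prod_(q < k) F (snoc_index J j q) = \prod_p F (J p) * F j.
Proof.
case: k J => // k J _ /=; rewrite big_ord_recr /=; congr (_ * _).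
  apply: eq_bigr => p _; rewrite ffunE insubT //= => lt_p.
  by congr (F (J _)); apply: val_inj.
by rewrite ffunE insubF //= ltnn.
Qed.

Lemma dotZr {R : realType} {n : nat} (a : R) (x y : 'cV[R]_n) : dot x (a *: y) = a * dot x y.
Proof.
by rewrite /dot mulr_sumr; apply: eq_bigr => i _; rewrite mxE mulrCA.
Qed.

Lemma dot_sumr {R : realType} {n : nat} (x : 'cV[R]_n) (y : 'I_n -> 'cV[R]_n) :
  dot x (\sum_r y r) = \sum_r dot x (y r).
Proof.
rewrite /dot exchange_big /=; apply: eq_bigr => i _.
by rewrite summxE mulr_sumr.
Qed.

(** The m-fold Kronecker power of [x], as a row because [eigenvalue] refers to left eigenvectors. *)
Definition kron_power {R : realType} {n : nat} (m : nat) (x : 'cV[R]_n) :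
    'rV[R]_(n ^ m) :=
  \row_j \prod_(p < m) x (digit j p) 0.

Lemma kron_power_dot {R : realType} {n : nat} (m : nat) (x y : 'cV[R]_n) :
  \sum_j kron_power m x 0 j * kron_power m y 0 j = dot x y ^+ m.
Proof.
rewrite -sum_prod_digit; apply: eq_bigr => j _.
by rewrite !mxE -big_split.
Qed.

Section Odeco.
Context {R : realType} {n k : nat} {A : tensor R n k}.
Context {lambda : 'I_n -> R} {v : 'I_n -> 'cV[R]_n}.
Hypothesis v_on : orthonormal v.
Hypothesis AE : forall J, A J = \sum_r lambda r * outer (fun _ : 'I_k => v r) J.

Lemma unfold_mx_odeco (k_even : ~~ odd k) j i :
  unfold_mx k_even A j i =
  \sum_r lambda r * (kron_power k./2 (v r) 0 j * kron_power k./2 (v r) 0 i).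
Proof.
rewrite mxE AE; apply: eq_bigr => r _; congr (_ * _).
rewrite /outer !mxE -big_split /=.
rewrite -(prod_half_ord _ _ k_even
  (fun b p => v r (digit (if b then i else j) p) 0)).
by apply: eq_bigr => q _; rewrite ffunE.
Qed.

(** By [unfold_mx_odeco] the matrix is a sum of rank-one terms built from the Kronecker powers,
    which are orthonormal because their dot products are powers of those of the [v r]. *)
Lemma kron_power_eigen (k_gt1 : (1 < k)%N) (k_even : ~~ odd k) s :
  kron_power k./2 (v s) *m unfold_mx k_even A =
  lambda s *: kron_power k./2 (v s).
Proof.
have m_gt0 : (0 < k./2)%N by rewrite half_gt0.
apply/rowP => i; rewrite mxE.
under eq_bigr => j _ do rewrite unfold_mx_odeco big_distrr /=.
rewrite exchange_big /=.
have termE r : \sum_j kron_power k./2 (v s) 0 j *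
    (lambda r * (kron_power k./2 (v r) 0 j * kron_power k./2 (v r) 0 i)) =
    (s == r)%:R * (lambda r * kron_power k./2 (v r) 0 i).
  under eq_bigr => j _ do
    rewrite (mulrCA (lambda r)) (mulrA (kron_power _ (v s) 0 j)).
  rewrite -mulr_suml kron_power_dot v_on.
  (* For distinct indices the power 0^(k/2) vanishes because k/2 is positive. *)
  by case: (s == r); rewrite ?expr1n // expr0n eqn0Ngt m_gt0.
rewrite (bigD1 s) //= termE eqxx mul1r big1 ?addr0 ?mxE // => r rs.
by rewrite termE eq_sym (negPf rs) mul0r.
Qed.

Lemma le_spectral_radius_odeco (k_gt1 : (1 < k)%N) (k_even : ~~ odd k) s :
  `|lambda s| <= spectral_radius (unfold_mx k_even A).
Proof.
have n_gt0 : (0 < n)%N := leq_ltn_trans (leq0n s) (ltn_ord s).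
have [|_] := @spectral_radius_max R _ (unfold_mx k_even A).
  by rewrite expn_gt0 n_gt0.
apply; exists (real_complex R (lambda s)); last exact: normc_real.
apply/eigenvalueP; exists (map_mx (real_complex R) (kron_power k./2 (v s))).
  by rewrite -map_mxM kron_power_eigen // map_mxZ.
(* The eigenvector is nonzero: its squared norm is <v_s, v_s>^(k/2) = 1. *)
rewrite map_mx_eq0; apply/eqP => w0.
have := kron_power_dot k./2 (v s) (v s).
rewrite v_on eqxx expr1n w0 big1 => [|j _]; last by rewrite mxE mul0r.
by move/eqP; rewrite eq_sym oner_eq0.
Qed.

(** For each r the sum over multi-indices factors into k-1 copies of <v_r, x>; the last mode leaves
    the vector v_r. *)
Lemma contract_odeco (k_gt0 : (0 < k)%N) (x : 'cV[R]_n) :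
  contract A x = \sum_r (lambda r * dot (v r) x ^+ k.-1) *: v r.
Proof.
apply/colP => j; rewrite mxE summxE.
under eq_bigr => J _ do rewrite AE mulr_suml.
rewrite exchange_big /=; apply: eq_bigr => r _; rewrite mxE.
rewrite -[in RHS](card_ord k.-1) -prodr_const /dot bigA_distr_bigA /=.
rewrite mulr_sumr mulr_suml; apply: eq_bigr => J _.
rewrite /outer (prod_snoc_index _ _ _ (fun i => v r i 0)) // big_split /= -!mulrA; congr (_ * (_ * _)).
exact: mulrC.
Qed.

Lemma dot_contract_odeco (k_gt0 : (0 < k)%N) (x : 'cV[R]_n) s :
  dot (v s) (contract A x) = lambda s * dot (v s) x ^+ k.-1.
Proof.
rewrite contract_odeco // dot_sumr (bigD1 s) //= big1 => [|r rs].
  by rewrite addr0 dotZr v_on eqxx mulr1.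
by rewrite dotZr v_on eq_sym (negPf rs) mulr0.
Qed.

(** Bessel's inequality for one unit vector: 0 <= |x - c v_s|^2 = |x|^2 - c^2 with c = <v_s, x>. *)
Lemma dot_le_norm (x : 'cV[R]_n) s : `|dot (v s) x| <= euclid_norm x.
Proof.
set c := dot (v s) x.
rewrite -sqrtr_sqr ler_wsqrtr //.
have : 0 <= dot (x - c *: v s) (x - c *: v s).
  by apply: sumr_ge0 => i _; rewrite -expr2 sqr_ge0.
have -> : dot (x - c *: v s) (x - c *: v s) =
    dot x x - c * dot (v s) x *+ 2 + c ^+ 2 * dot (v s) (v s).
  rewrite /dot !mulr_sumr -sumrMnl -sumrB -big_split /=.
  by apply: eq_bigr => i _; rewrite !mxE; ring.
by rewrite v_on eqxx mulr1 -/c -expr2 mulr2n opprD addrA subrK subr_ge0.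
Qed.

Lemma dot_trajectory_le (k_gt1 : (1 < k)%N) (mu : R) (x0 : 'cV[R]_n) s t :
  `|lambda s| <= mu -> mu * euclid_norm x0 ^+ (k - 2) <= 1 ->
  `|dot (v s) (trajectory A x0 t)| <=
    (mu * euclid_norm x0 ^+ (k - 2)) ^+ t * euclid_norm x0.
Proof.
move=> le_mu q_le1; set q := mu * _.
have mu_ge0 : 0 <= mu := le_trans (normr_ge0 _) le_mu.
have N_ge0 : 0 <= euclid_norm x0 := sqrtr_ge0 _.
have q_ge0 : 0 <= q by rewrite mulr_ge0 ?exprn_ge0.
elim: t => [|t IH]; first by rewrite expr0 mul1r dot_le_norm.
rewrite /trajectory iterS -/(trajectory A x0 t) dot_contract_odeco ?(ltnW k_gt1) //.
set c := dot _ _ in IH *.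
have c_le : `|c| <= euclid_norm x0.
  by apply: le_trans IH _; rewrite ler_piMl ?exprn_ile1.
(* Of the k-1 factors |c|, k-2 are bounded by the initial norm and combine with |lambda_s| <= mu
   into one factor q; the remaining one is bounded by the induction hypothesis. *)
have -> : k.-1 = (k - 2).+1 by rewrite subn2 prednK // -subn1 subn_gt0.
rewrite normrM normrX exprSr mulrA [q ^+ t.+1]exprS -(mulrA q).
rewrite ler_pM ?mulr_ge0 ?exprn_ge0 //.
by rewrite ler_pM ?exprn_ge0 // lerXn2r ?nnegrE.
Qed.

Lemma odeco_trajectory_cvg0 (k_gt1 : (1 < k)%N) (mu : R) (x0 : 'cV[R]_n) :
  (forall s, `|lambda s| <= mu) -> 0 <= mu ->
  mu * euclid_norm x0 ^+ (k - 2) < 1 ->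
  trajectory A x0 @ \oo --> (0 : 'cV[R]_n).
Proof.
move=> le_mu mu_ge0 q_lt1.
have q_ge0 : 0 <= mu * euclid_norm x0 ^+ (k - 2).
  by rewrite mulr_ge0 ?exprn_ge0 ?sqrtr_ge0.
have dot_cvg0 s : dot (v s) (trajectory A x0 t) @[t --> \oo] --> (0 : R).
  apply/norm_cvg0P.
  apply: (@squeeze_cvgr _ _ _ _ (cst 0)
    (fun t => (mu * euclid_norm x0 ^+ (k - 2)) ^+ t * euclid_norm x0)).
  - near=> t; rewrite normr_ge0 /=.
    by apply: dot_trajectory_le => //; exact: ltW.
  - exact: cvg_cst.
  - rewrite -[X in _ --> X](mul0r (euclid_norm x0)).
    by apply: cvgMr_tmp; apply: cvg_expr; rewrite ger0_norm.
(* From time 1 on the state is a value of [contract], hence a combination of the [v s] by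
   [contract_odeco]; shifting time by one does not affect the limit. *)
have trajS : [sequence trajectory A x0 t.+1]_t =
    fun t => \sum_s dot (v s) (trajectory A x0 t.+1) *: v s.
  apply/funext => t; have k_gt0 := ltnW k_gt1.
  rewrite -[LHS]/(contract A (trajectory A x0 t)) contract_odeco //.
  by apply: eq_bigr => s _; rewrite -dot_contract_odeco.
have sum_cvg : \sum_s dot (v s) (trajectory A x0 t.+1) *: v s @[t --> \oo] -->
    \sum_s 0 *: v s.
  apply: cvg_big => [|s _]; first exact: add_continuous.
  apply: cvgZr_tmp.
  by rewrite (cvg_shiftS (fun t => dot (v s) (trajectory A x0 t))).
rewrite -cvg_shiftS trajS.
have sum0 : \sum_s 0 *: v s = 0 by rewrite big1 // => s _; rewrite scale0r.
by rewrite sum0 in sum_cvg.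
Unshelve. all: by end_near.
Qed.

End Odeco.

Theorem corollary2 (R : realType) (n k : nat) (n_ge1 : (1 <= n)%N)
    (k_ge4 : (4 <= k)%N) (k_even : ~~ odd k) (A : tensor R n k)
    (A_sym : supersymmetric A) (A_odeco : odeco A) (x0 : 'cV[R]_n) :
  spectral_radius (unfold_mx k_even A) `^ (k - 2)%:R^-1 * euclid_norm x0 < 1 ->
  asymptotically_stable A x0.
Proof.
have [lambda [v [v_on AE]]] := A_odeco.
have k_gt1 : (1 < k)%N by apply: leq_trans k_ge4.
have k2_gt0 : (0 < k - 2)%N by rewrite subn_gt0 (leq_trans _ k_ge4).
have le_mu := le_spectral_radius_odeco v_on AE k_gt1 k_even.
set mu := spectral_radius _ in le_mu * => small.
have mu_ge0 : 0 <= mu := le_trans (normr_ge0 _) (le_mu (Ordinal n_ge1)).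
apply: (odeco_trajectory_cvg0 v_on AE k_gt1 _ _ le_mu mu_ge0).
(* The required bound mu |x_0|^(k-2) < 1 is the assumed inequality raised to the positive power
   k-2. *)
have -> : mu = (mu `^ (k - 2)%:R^-1) ^+ (k - 2).
  by rewrite -powR_mulrn ?powR_ge0 // -powRrM mulVf ?powRr1 // pnatr_eq0 -lt0n.
by rewrite -exprMn exprn_ilt1 ?mulr_ge0 ?powR_ge0 ?sqrtr_ge0 // -lt0n.
Qed.
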